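(* Suppose that the Markov decision process $M_{\infty}$ is communicating. Then for $\{\pi_k(H), k\geq 1\}$ generated by on-line asynchronous PIPS, there exists some $K < \infty$ such that $\pi_k(H) = \pi^*(H)$ for all $k > K$, where $V^{\pi^*(H)}_H = V^*_H$ in $M_H$, for any $\pi_1(H)\in \Pi(X)^H$ and any $\{\Delta_k\}$ where $\Delta_k\subseteq \Pi(X)^H$, $k\geq 1$.
   Context: Setting: $M_\infty$ is an infinite-horizon discounted Markov decision process with finite state set $X$, finite action set $A$, admissible-action sets $A(x)\subseteq A$ for $x\in X$, reward function $R:X\times A\to\mathbb{R}$, transition probabilities $P^a_{xy}$ (the probability of moving from $x$ to $y$ under action $a$), and discount factor $\gamma\in(0,1)$. A finite forecast-horizon $H\ge 1$ is fixed, and $M_H$ is the $H$-horizon sub-MDP of $M_\infty$. $\Pi(X)$ is the set of all maps $\pi:X\to A$ with $\pi(x)\in A(x)$ for all $x\in X$. An $H$-length policy is a tuple $\pi=(\pi_1,\dots,\pi_H)\in\Pi(X)^H$; for $x\in X$, $\pi(x)$ denotes $(\pi_1(x),\dots,\pi_H(x))$. The entries of a policy written $\pi_k(H)\in\Pi(X)^H$ are denoted $\pi_k(H)_1,\dots,\pi_k(H)_H$. Value functions: for $\pi\in\Pi(X)^H$ and $h\in\{1,\dots,H\}$, $$V^\pi_h(x)=E\left[\sum_{l=1}^h\gamma^{l-1}R(X_l,\pi_l(X_l))\;\Big|\; X_1=x\right],\quad x\in X,$$ where $X_l$ is the random state at level $l$ when following the $l$th entry $\pi_l$ of $\pi$;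 and $V^\pi_0(x)=0$ for all $x\in X$. The optimal $H$-horizon value function is $V^*_H(x)=\max_{\pi\in\Pi(X)^H}V^\pi_H(x)$, $x\in X$; $\pi^*(H)\in\Pi(X)^H$ denotes an optimal $H$-length policy, i.e. one with $V^{\pi^*(H)}_H=V^*_H$. Communicating: $M_\infty$ is communicating if for every $\pi\in\Pi(X)$ the Markov chain on $X$ induced by the stationary policy that always uses $\pi$ (transition probabilities $P^{\pi(x)}_{xy}$) is communicating, i.e. every two states communicate with each other. Switchable and improvable sets: for $\pi\in\Pi(X)^H$, $x\in X$, $h\in\{1,\dots,H\}$, $$S^{\pi}_h(x) = \Big\{ a \in A(x) \;\Big|\; R(x,a) + \gamma \sum_{y\in X} P^{a}_{xy}V^{\pi}_{h-1}(y) > V^{\pi}_h(x) \Big\},$$ and $I^{\pi,H}_x=\{(h,x)\mid h\in\{1,\dots,H\},\ S^\pi_h(x)\ne\emptyset\}$. Let $\beta^{\pi,H}_x$ be the set of all $\tilde\pi\in\Pi(X)^H$ for which there is a nonempty $I\subseteq I^{\pi,H}_x$ with $\tilde\pi_{H-h+1}(x)\in S^\pi_h(x)$ for all $h$ such that $(h,x)\in I$, and $\tilde\pi_{H-h+1}(x')=\pi_{H-h+1}(x')$ for all $(h,x')\in(\{1,\dots,H\}\times X)\setminus I$ (so $\beta^{\pi,H}_x=\emptyset$ if $I^{\pi,H}_x=\emptyset$). Policy switching: for nonempty $\Delta\subseteq\Pi(X)^H$, $\pi_{\mathrm{ps}}(\Delta)\in\Pi(X)^H$ is constructed so that, for each pair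 of $x\in X$ and $h\in\{1,\dots,H\}$, $\pi_{\mathrm{ps}}(\Delta)_h(x)=\phi^*_h(x)$ where $\phi^*\in\arg\max_{\phi\in\Delta}V^\phi_{H-h+1}(x)$. On-line asynchronous PIPS (policy iteration with policy switching): $x_k\in X$ is the state of the system at time $k\ge1$, and $\Delta_k\subseteq\Pi(X)^H$ is a given set of ''supervisors'' at time $k$. Select $\pi_1(H)\in\Pi(X)^H$ arbitrarily and set $\phi_1=\pi_1(H)_1$. At each $k>1$: if $\beta^{\pi_{k-1}(H),H}_{x_k}=\emptyset$, then $\pi_k(H)=\pi_{k-1}(H)$; otherwise $\pi_k(H)(x_k)=\pi_{\mathrm{ps}}\big(\beta^{\pi_{k-1}(H),H}_{x_k}\cup\Delta_k\big)(x_k)$ and $\pi_k(H)(x)=\pi_{k-1}(H)(x)$ for all $x\in X\setminus\{x_k\}$. Then $\phi_k=\pi_k(H)_1$. At each $k\ge1$ the action $\phi_k(x_k)$ is taken and the system makes a random transition to $x_{k+1}$ with probability $P^{\phi_k(x_k)}_{x_kx_{k+1}}$.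
   Formalization: For h < H, the value V^π_h follows the last h entries of π; with the displayed formula (first h entries) the claim fails already for one state and H = 2. The convergence is almost sure, with K and π*(H) depending on the sample path. *)

(* Defs.v *)
From HB Require Import structures.
From mathcomp Require Import all_boot all_order all_algebra.
From mathcomp Require Import all_classical all_reals all_analysis.

Set Implicit Arguments.
Unset Strict Implicit.
Unset Printing Implicit Defensive.

Import Order.TTheory GRing.Theory Num.Theory.

Local Open Scope ring_scope.

Section MDP.
Variables (R : realType) (X A : finType).

Record mdp := MDP {
  adm : X -> {set A};
  reward : X -> A -> R;
  trans : X -> A -> X -> R;  (* [trans x a y] is P^a_{xy} *)
  discount : R;
  trans_ge0 : forall x a y, a \in adm x -> 0 <= trans x a y;
  trans_sum1 : forall x a, a \in adm x -> \sum_y trans x a y = 1;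
  discount_gt0 : 0 < discount;
  discount_lt1 : discount < 1
}.

Definition rule := {ffun X -> A}.

(* Entries are numbered from 0: [tnth p i] is the (i+1)-st entry of [p]. *)
Definition policy (H : nat) := (H.-tuple rule)%type.

Variable M : mdp.

Definition Pi : {set rule} := [set f : rule | [forall x, f x \in adm M x]].

Definition PiH (H : nat) : {set policy H} :=
  [set p : policy H | [forall i, tnth p i \in Pi]].

Fixpoint nstep (f : rule) (n : nat) (x y : X) : R :=
  if n is n'.+1 then \sum_z trans M x (f x) z * nstep f n' z y
  else (x == y)%:R.

Definition accessible (f : rule) (x y : X) : Prop :=
  exists n, 0 < nstep f n x y.

Definition communicating : Prop :=
  forall f, f \in Pi ->
  forall x y, accessible f x y /\ accessible f y x.

(* Probability of the trajectory [w] of the chain started at [x] that uses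
   the rule [tnth s i] on its (i+1)-st state.  Each product over [j] has at
   most one factor: it only names the index 0, resp. i+1, when it is < n. *)
Definition traj_prob n (s : n.-tuple rule) (x : X) (w : {ffun 'I_n -> X}) : R :=
  (\prod_(j < n | j == 0%N :> nat) (w j == x)%:R) *
  \prod_(i < n) \prod_(j < n | j == i.+1 :> nat)
     trans M (w i) (tnth s i (w i)) (w j).

Definition traj_reward n (s : n.-tuple rule) (w : {ffun 'I_n -> X}) : R :=
  \sum_(l < n) discount M ^+ l * reward M (w l) (tnth s l (w l)).

Definition expected_reward n (s : n.-tuple rule) (x : X) : R :=
  \sum_(w : {ffun 'I_n -> X}) traj_prob s x w * traj_reward s w.

(* [V p h] is the value of [p] with [h] levels to go: it follows the last [h]
   entries p_{H-h+1}, ..., p_H.  This is the indexing under which the sets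
   [switchable p h x], whose members replace p_{H-h+1}(x), and [is_switching],
   which ranks h-th entries by the value with H-h+1 levels to go, are one-step
   improvements.  For [h = H] all entries are used. *)
Definition V H (p : policy H) (h : nat) (x : X) : R :=
  expected_reward [tuple of drop (H - h) p] x.

(* The maximum over the finite set [PiH H]. *)
Definition Vstar (H : nat) (x : X) : R :=
  sup [set V p H x | p in [set q | q \in PiH H]]%classic.

Definition optimal H (p : policy H) : Prop :=
  p \in PiH H /\ forall x, V p H x = Vstar H x.

Definition switchable H (p : policy H) (h : nat) (x : X) : {set A} :=
  [set a in adm M x |
     V p h x < reward M x a + discount M * \sum_y trans M x a y * V p h.-1 y].

(* A number h in {1, ..., H} of levels to go is encoded as [h' : 'I_H] with
   h = h'+1; the entry p_{H-h+1} is then [tnth p (rev_ord h')]. *)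
Definition improvable H (p : policy H) (x : X) : {set 'I_H * X} :=
  [set hy : 'I_H * X | (hy.2 == x) && (switchable p hy.1.+1 x != finset.set0)].

Definition beta H (p : policy H) (x : X) : {set policy H} :=
  [set q in PiH H | [exists I : {set 'I_H * X},
    [&& I != finset.set0,
        I \subset improvable p x,
        [forall h : 'I_H, ((h, x) \in I) ==>
           (tnth q (rev_ord h) x \in switchable p h.+1 x)]
      & [forall hy : 'I_H * X, (hy \notin I) ==>
           (tnth q (rev_ord hy.1) hy.2 == tnth p (rev_ord hy.1) hy.2)]]]].

(* [q] is a possible value of pi_ps(D).  The maximizer may be chosen freely and
   separately for each pair of a state and a level, hence a relation. The level
   i+1 has H-(i+1)+1 = H-i levels to go. *)
Definition is_switching H (D : {set policy H}) (q : policy H) : Prop :=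
  forall (x : X) (i : 'I_H), exists phi : policy H,
    [/\ phi \in D,
        forall psi, psi \in D -> V psi (H - i) x <= V phi (H - i) x
      & tnth q i x = tnth phi i x].

Definition pips_step H (D : {set policy H}) (x : X) (p p' : policy H) : Prop :=
  if beta p x == finset.set0 then p' = p
  else exists q : policy H,
    [/\ is_switching (beta p x :|: D) q,
        forall i, tnth p' i x = tnth q i x
      & forall i y, y != x -> tnth p' i y = tnth p i y].

(* A run of the on-line algorithm: [x_ k] is the state and [pi_ k] the policy
   at time [k], for [1 <= k]; index 0 is not used.  [Delta] may depend on the
   outcome, so that supervisors may be chosen along the run.  The last field
   says that, given the states and policies up to time [k], the next state has
   the law P^a_{x_k y} where [a] is given by the first entry of the policy. *)
Record online_pips (H : nat) (H_gt0 : (0 < H)%N) (pi1 : policy H)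
    (d : measure_display) (Omega : measurableType d) (Pr : probability Omega R)
    (Delta : nat -> Omega -> {set policy H})
    (x_ : nat -> Omega -> X) (pi_ : nat -> Omega -> policy H) : Prop :=
  OnlinePips {
    state_measurable : forall k x, (1 <= k)%N ->
      measurable [set w | x_ k w = x]%classic;
    policy_measurable : forall k p, (1 <= k)%N ->
      measurable [set w | pi_ k w = p]%classic;
    pips_init : forall w, pi_ 1%N w = pi1;
    pips_next : forall k w, (1 < k)%N ->
      pips_step (Delta k w) (x_ k w) (pi_ k.-1 w) (pi_ k w);
    pips_transition : forall (k : nat) (xs : nat -> X) (ps : nat -> policy H)
        (y : X), (1 <= k)%N ->
      let history := [set w | forall j, (1 <= j <= k)%N ->
                                x_ j w = xs j /\ pi_ j w = ps j]%classic in
      (Pr (history `&` [set w | x_ k.+1 w = y])%classic =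
       Pr history *
       (trans M (xs k) (tnth (ps k) (Ordinal H_gt0) (xs k)) y)%:E)%E
  }.

End MDP.

(* Main.v *)
Require Import Defs.
From HB Require Import structures.
From mathcomp Require Import all_boot all_order all_algebra.
From mathcomp Require Import all_classical all_reals all_analysis.

Set Implicit Arguments.
Unset Strict Implicit.
Unset Printing Implicit Defensive.

Import Order.TTheory GRing.Theory Num.Theory.

Local Open Scope ring_scope.

(** Supervisors may be much better than the current policy away from x_k, so a
    step can decrease its values, and monotone improvement is not available.
    One argues instead by induction on the number h of levels to go.  Once the
    values with at most h levels to go are optimal, no step changes them: the
    switched policy plays at x_k the action of a member of beta or Delta whose
    value is at least the optimal one, since beta contains a policy with optimal
    value at level h+1.  For the same reason every visit to a state makes its
    value at level h+1 optimal for good.  So the policy becomes optimal at all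
    levels, hence has empty improvable sets and is constant, as soon as every
    state is visited often enough.

    Every state is visited infinitely often almost surely, although the rule in
    use changes with time.  If an adversary choosing the actions could avoid y
    for ever, a stationary rule could, against communication.  Hence y is hit
    within |X| steps with probability at least e ^ |X|, where e bounds the
    positive transition probabilities from below, whatever the past. *)

(** * One-step recursion for the values *)

Section ExpectedReward.
Variables (R : realType) (X A : finType) (M : mdp R X A).

Definition ffcons n (x : X) (w : {ffun 'I_n -> X}) : {ffun 'I_n.+1 -> X} :=
  [ffun i => oapp w x (unlift ord0 i)].

Lemma ffcons0 n x (w : {ffun 'I_n -> X}) : ffcons x w ord0 = x.
Proof. by rewrite ffunE unlift_none. Qed.

Lemma ffconsS n x (w : {ffun 'I_n -> X}) i : ffcons x w (lift ord0 i) = w i.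
Proof. by rewrite ffunE liftK. Qed.

Lemma sum_ffcons n (F : {ffun 'I_n.+1 -> X} -> R) :
  \sum_w F w = \sum_x \sum_w F (ffcons x w).
Proof.
rewrite pair_big /= (reindex (fun p => ffcons p.1 p.2)) //=.
exists (fun w : {ffun 'I_n.+1 -> X} => (w ord0, [ffun i => w (lift ord0 i)])).
  move=> [x w] _ /=; rewrite ffcons0; congr pair.
  by apply/ffunP => i; rewrite ffunE ffconsS.
move=> w _ /=; apply/ffunP => i; rewrite ffunE.
by case: unliftP => [j|] -> //=; rewrite ffunE.
Qed.

Lemma prod_ord0 n (g : 'I_n.+1 -> R) :
  \prod_(j < n.+1 | j == 0%N :> nat) g j = g ord0.
Proof. by rewrite (big_pred1 ord0). Qed.

Lemma traj_prob_cons n (f : rule X A) (s : n.-tuple (rule X A)) x z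
    (w : {ffun 'I_n -> X}) :
  f x \in adm M x ->
  traj_prob M [tuple of f :: s] x (ffcons z w) =
  (z == x)%:R * \sum_y trans M x (f x) y * traj_prob M s y w.
Proof.
move=> fx; rewrite {1}/traj_prob prod_ord0 ffcons0; case: eqVneq => [->|_]; last by rewrite !mul0r.
rewrite !mul1r big_ord_recl ffcons0 tnth0 big_mkcond big_ord_recl /= mul1r.
rewrite -big_mkcond /=.
under eq_bigr do rewrite ffconsS.
under [X in _ * X = _]eq_bigr => i _.
  rewrite big_mkcond big_ord_recl /= mul1r -big_mkcond /=.
  under eq_bigr do rewrite !ffconsS tnthS.
  over.
rewrite /traj_prob.
under [RHS]eq_bigr do rewrite mulrA.
rewrite -mulr_suml; congr (_ * _).
(* For [n = 0] the empty tail has weight 1, and the sum is the total mass of the transition law.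
   Otherwise the initial indicator of the tail keeps only [y = w ord0]. *)
case: n s w => [|n] s w.
  rewrite big_ord0; under eq_bigr do rewrite big_ord0 mulr1.
  by rewrite trans_sum1.
rewrite prod_ord0.
under eq_bigr do rewrite prod_ord0.
rewrite (bigD1 (w ord0)) //= eqxx mulr1 big1 ?addr0 // => y.
by rewrite eq_sym => /negbTE ->; rewrite mulr0.
Qed.

Lemma traj_reward_cons n (f : rule X A) (s : n.-tuple (rule X A)) z
    (w : {ffun 'I_n -> X}) :
  traj_reward M [tuple of f :: s] (ffcons z w) =
  reward M z (f z) + discount M * traj_reward M s w.
Proof.
rewrite /traj_reward big_ord_recl ffcons0 tnth0 expr0 mul1r mulr_sumr.
congr (_ + _); apply: eq_bigr => i _.
by rewrite ffconsS tnthS mulrA exprS.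
Qed.

Lemma sum_traj_prob n (s : n.-tuple (rule X A)) x :
  {in s, forall f, f \in Pi M} -> \sum_w traj_prob M s x w = 1.
Proof.
elim: n s x => [|n IH] s x sPi.
  rewrite (big_pred1 [ffun i => x]).
    by rewrite /traj_prob !big_ord0 mulr1.
  by move=> w; apply/esym/eqP/ffunP => -[].
case/tupleP: s sPi => f s sPi.
have fPi : f x \in adm M x.
  by have := sPi f (mem_head _ _); rewrite inE => /forallP.
rewrite sum_ffcons (bigD1 x) //= [X in _ + X]big1 ?addr0; last first.
  move=> z /negbTE zx; rewrite big1 // => w _.
  by rewrite traj_prob_cons // zx mul0r.
under eq_bigr do rewrite traj_prob_cons // eqxx mul1r.
rewrite exchange_big /=.
have s'Pi : {in s, forall g, g \in Pi M}.
  by move=> g gs; apply: sPi; rewrite inE gs orbT.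
under eq_bigr do rewrite -mulr_sumr IH // mulr1.
by rewrite trans_sum1.
Qed.

Definition lookahead (x : X) (a : A) (u : X -> R) : R :=
  reward M x a + discount M * \sum_y trans M x a y * u y.

Lemma expected_reward_cons n (f : rule X A) (s : n.-tuple (rule X A)) x :
  {in f :: s, forall g, g \in Pi M} ->
  expected_reward M [tuple of f :: s] x =
  lookahead x (f x) (expected_reward M s).
Proof.
move=> sPi.
have fPi : f x \in adm M x.
  by have := sPi f (mem_head _ _); rewrite inE => /forallP.
have s'Pi : {in s, forall g, g \in Pi M}.
  by move=> g gs; apply: sPi; rewrite inE gs orbT.
rewrite /expected_reward sum_ffcons (bigD1 x) //= [X in _ + X]big1 ?addr0.
  under eq_bigr do rewrite traj_prob_cons // traj_reward_cons eqxx mul1r mulrDr.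
  rewrite big_split /= -mulr_suml exchange_big /=.
  under eq_bigr do rewrite -mulr_sumr sum_traj_prob // mulr1.
  rewrite trans_sum1 // mul1r; congr (_ + _).
  rewrite mulr_sumr.
  under eq_bigr do rewrite mulr_suml.
  rewrite exchange_big /=; apply: eq_bigr => y _.
  rewrite !mulr_sumr; apply: eq_bigr => w _.
  by rewrite mulrCA !mulrA.
move=> z /negbTE zx; rewrite big1 // => w _.
by rewrite traj_prob_cons // zx !mul0r.
Qed.

Lemma V0 H (p : policy X A H) x : V M p 0 x = 0.
Proof.
rewrite /V /expected_reward big1 // => w _.
rewrite /traj_reward big1 ?mulr0 // => i.
by exfalso; case: i => m; rewrite subn0 subnn.
Qed.

(** The lengths [H - (H - h.+1)] and [(H - (H - h)).+1] agree only propositionally, so tuples are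
    compared through their underlying lists. *)
Lemma expected_reward_val m n (s : m.-tuple (rule X A)) (t : n.-tuple _) x :
  val s = val t -> expected_reward M s x = expected_reward M t x.
Proof.
move=> st; have mn : m = n by rewrite -(size_tuple s) st size_tuple.
by case: n / mn t st => t /val_inj ->.
Qed.

Lemma VS H (p : policy X A H) (h : 'I_H) x : p \in PiH M H ->
  V M p h.+1 x = lookahead x (tnth p (rev_ord h) x) (V M p h).
Proof.
move=> pPi.
have pall g : g \in p -> g \in Pi M.
  by move=> /tnthP [i ->]; move: pPi; rewrite inE => /forallP.
have E : drop (H - h.+1) p =
         tnth p (rev_ord h) :: drop (H - h) p.
  rewrite (tnth_nth (tnth p (rev_ord h))) /= (drop_nth (tnth p (rev_ord h))).
    by rewrite -subSn // subSS.
  by rewrite size_tuple ltn_subrL /= (leq_ltn_trans _ (ltn_ord h)).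
rewrite /V (@expected_reward_val _ _ _
  [tuple of tnth p (rev_ord h) :: [tuple of drop (H - h) p]]) //.
apply: expected_reward_cons => g; rewrite -E => /mem_drop; exact: pall.
Qed.
End ExpectedReward.

(** * Optimal values by backward induction *)

Section Bellman.
Variables (R : realType) (X A : finType) (M : mdp R X A) (H : nat).
Variable f0 : rule X A.
Hypothesis f0_adm : f0 \in Pi M.

(** The default [f0 x] of the arg max is admissible, so there is always an action to maximize
    over. *)
Fixpoint bellman (h : nat) (x : X) : R :=
  if h is h'.+1 then
    lookahead M x
      [arg max_(a > f0 x in adm M x) lookahead M x a (bellman h')]%O (bellman h')
  else 0.

Lemma le_bellman h x a : a \in adm M x ->
  lookahead M x a (bellman h) <= bellman h.+1 x.
Proof.
move=> ax /=; case: arg_maxP => [|b _]; last exact.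
by move: f0_adm; rewrite inE => /forallP.
Qed.

Lemma bellman_attained h x :
  exists2 a, a \in adm M x & bellman h.+1 x = lookahead M x a (bellman h).
Proof.
move=> /=; case: arg_maxP => [|b bx _]; last by exists b.
by move: f0_adm; rewrite inE => /forallP.
Qed.

Lemma le_lookahead x a (u v : X -> R) : a \in adm M x ->
  (forall y, u y <= v y) -> lookahead M x a u <= lookahead M x a v.
Proof.
move=> ax uv; rewrite lerD2l ler_wpM2l ?(ltW (discount_gt0 M)) //.
by apply: ler_sum => y _; rewrite ler_wpM2l ?trans_ge0.
Qed.

Lemma tnth_adm (p : policy X A H) i x :
  p \in PiH M H -> tnth p i x \in adm M x.
Proof. by rewrite inE => /forallP/(_ i); rewrite inE => /forallP. Qed.

Lemma V_le_bellman (p : policy X A H) h x : p \in PiH M H -> (h <= H)%N ->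
  V M p h x <= bellman h x.
Proof.
move=> pPi; elim: h x => [|h IH] x hH; first by rewrite V0.
rewrite (VS (Ordinal hH)) //.
apply: le_trans (le_bellman h (tnth_adm (rev_ord (Ordinal hH)) x pPi)).
by apply: le_lookahead => [|y]; [exact: tnth_adm | exact/IH/ltnW].
Qed.

Lemma eq_V (p q : policy X A H) h : p \in PiH M H -> q \in PiH M H ->
  (h <= H)%N ->
  (forall (i : 'I_H) x, (i < h)%N ->
    tnth p (rev_ord i) x = tnth q (rev_ord i) x) ->
  V M p h = V M q h.
Proof.
move=> pPi qPi; elim: h => [|h IH] hH pq; apply/funext => x.
  by rewrite !V0.
rewrite !(VS (Ordinal hH)) //= pq // IH //; first exact: ltnW.
by move=> i y ih; apply/pq/ltnW.
Qed.

(** With an optimal continuation, an action attaining the maximum in [bellman] is a strict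
    improvement as long as the value is not optimal, and no action beats an optimal value. *)
Lemma switchable_eq0 (p : policy X A H) (h : 'I_H) x : p \in PiH M H ->
  V M p h = bellman h ->
  (switchable M p h.+1 x == finset.set0) = (V M p h.+1 x == bellman h.+1 x).
Proof.
move=> pPi Vh; apply/eqP/eqP => [S0|Vx].
  have [a ax Wa] := bellman_attained h x.
  apply/le_anti; rewrite V_le_bellman //= leNgt; apply/negP => ltV.
  have : a \in switchable M p h.+1 x.
    by rewrite inE ax /= Vh -[_ + _]/(lookahead _ _ _ _) -Wa.
  by rewrite S0 inE.
apply/setP => a; rewrite !inE; apply/negbTE/negP => /andP[ax].
by rewrite Vx /= Vh ltNge => /negP; apply; exact: le_bellman.
Qed.

(** * Effect of one step of the algorithm on the values *)

Definition set_action (p : policy X A H) (i : 'I_H) (x : X) (a : A) :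
    policy X A H :=
  [tuple [ffun y => if (j == i) && (y == x) then a else tnth p j y] | j < H].

Lemma tnth_set_action p i x a j y :
  tnth (set_action p i x a) j y =
  if (j == i) && (y == x) then a else tnth p j y.
Proof. by rewrite tnth_mktuple ffunE. Qed.

Lemma set_action_beta (p : policy X A H) (h : 'I_H) x a : p \in PiH M H ->
  a \in switchable M p h.+1 x -> set_action p (rev_ord h) x a \in beta M p x.
Proof.
move=> pPi aS; rewrite inE; apply/andP; split.
  rewrite inE; apply/forallP => i; rewrite inE; apply/forallP => y.
  rewrite tnth_set_action; case: ifP => [/andP[_ /eqP ->]|_].
    by move: aS; rewrite inE => /andP[].
  exact: tnth_adm.
apply/existsP; exists [set (h, x)]; apply/and4P; split.
- by apply/set0Pn; exists (h, x); rewrite inE.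
- by rewrite finset.sub1set inE eqxx /=; apply/set0Pn; exists a.
- apply/forallP => i; apply/implyP; rewrite inE => /eqP[->].
  by rewrite tnth_set_action !eqxx.
- apply/forallP => -[i y] /=; apply/implyP; rewrite inE xpair_eqE.
  by rewrite tnth_set_action (inj_eq rev_ord_inj) => /negbTE ->.
Qed.

Lemma beta_sub_PiH (p : policy X A H) x : beta M p x \subset PiH M H.
Proof. by apply/fintype.subsetP => q; rewrite inE => /andP[]. Qed.

Lemma pips_step_PiH (D : {set policy X A H}) x p p' :
  p \in PiH M H -> D \subset PiH M H -> pips_step M D x p p' ->
  p' \in PiH M H.
Proof.
rewrite /pips_step => pPi DPi; case: ifP => [_ -> //|_ [q [qsw p'x p'y]]].
rewrite inE; apply/forallP => i; rewrite inE; apply/forallP => y.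
have [->|/p'y ->] := eqVneq y x; last exact: tnth_adm.
have [phi [phiD _ qphi]] := qsw x i.
rewrite p'x qphi tnth_adm //; move: phiD; rewrite !inE => /orP[/andP[]//|].
by move=> /(fintype.subsetP DPi); rewrite inE.
Qed.

Definition solved (p : policy X A H) (h : nat) :=
  forall j, (j <= h)%N -> V M p j = bellman j.

(** If nothing is switchable at level [h.+1], the value there is already optimal, and members of
    [beta] differ from [p] only with more than [h.+1] levels to go. Otherwise an optimal action is
    itself switchable, and switching to it alone leaves the continuation intact. *)
Lemma beta_value_ge (p : policy X A H) (h : 'I_H) x :
  p \in PiH M H -> solved p h -> beta M p x != finset.set0 ->
  exists2 psi, psi \in beta M p x & V M psi h.+1 x = bellman h.+1 x.
Proof.
move=> pPi ph /set0Pn[psi psib].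
have betaPi := fintype.subsetP (beta_sub_PiH p x).
have [S0|[a aS]] := set_0Vmem (switchable M p h.+1 x).
  exists psi => //.
  have Vh : V M p h.+1 x = bellman h.+1 x.
    by apply/eqP; rewrite -switchable_eq0 ?S0 // ph.
  rewrite -Vh; congr (_ x); apply: eq_V => //; first exact: betaPi.
  move=> i y ih; move: psib; rewrite inE => /andP[_ /existsP[I /and4P[_ II _]]].
  move=> /forallP/(_ (i, y))/implyP psiI; apply/eqP/psiI/negP.
  move=> /(fintype.subsetP II); rewrite inE /= => /andP[_ /negP]; apply.
  move: ih; rewrite ltnS leq_eqVlt => /orP[/eqP/val_inj ->|ih].
    exact/eqP.
  by rewrite switchable_eq0 ?ph // ltnW.
have [b bx Wb] := bellman_attained h x.
have bS : b \in switchable M p h.+1 x.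
  rewrite inE bx /= (ph h) // -[_ + _]/(lookahead _ _ _ _) -Wb lt_neqAle.
  rewrite V_le_bellman // andbT -switchable_eq0 ?ph //.
  by apply/set0Pn; exists a.
have qb := set_action_beta pPi bS.
exists (set_action p (rev_ord h) x b) => //.
rewrite VS ?betaPi // tnth_set_action !eqxx Wb; congr lookahead.
rewrite -(ph h) //; apply: eq_V => [|//||i y ih]; first exact: betaPi.
  exact: ltnW.
by rewrite tnth_set_action (inj_eq rev_ord_inj) -val_eqE ltn_eqF.
Qed.

(** An empty [beta] means that nothing is switchable at [x]. Otherwise the maximizer [phi] does at
    least as well as the policy from [beta_value_ge]; the new policy copies only its action at [x],
    but continues optimally, hence no worse than [phi]. *)
Lemma pips_step_visited (D : {set policy X A H}) x p p' (h : 'I_H) :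
  p \in PiH M H -> D \subset PiH M H -> pips_step M D x p p' ->
  solved p h -> V M p' h = bellman h -> V M p' h.+1 x = bellman h.+1 x.
Proof.
move=> pPi DPi st ph p'h; have p'Pi := pips_step_PiH pPi DPi st.
move: st; rewrite /pips_step; case: ifPn => [/eqP b0 p'p|bn0 [q [qsw p'x _]]].
  apply/eqP; rewrite -switchable_eq0 // p'p; apply/eqP/setP => a.
  by rewrite [RHS]inE; apply/negP => /(set_action_beta pPi); rewrite b0 inE.
have [psi psib psiW] := beta_value_ge pPi ph bn0.
have [phi [phiD phimax qphi]] := qsw x (rev_ord h).
have hE : (H - rev_ord h)%N = h.+1 by rewrite /= subKn.
have phiPi : phi \in PiH M H.
  move: phiD; rewrite finset.in_setU => /orP[]; apply: fintype.subsetP => //.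
  exact: beta_sub_PiH.
apply/le_anti; rewrite V_le_bellman //= -[X in X <= _]psiW -hE.
apply: le_trans (phimax psi _) _; first by rewrite finset.in_setU psib.
rewrite hE !VS // p'h p'x qphi; apply: le_lookahead; first exact: tnth_adm.
by move=> y; rewrite V_le_bellman // ltnW.
Qed.

(** At the current state [pips_step_visited] applies; elsewhere the entry is kept and the
    continuation has the same optimal values. *)
Lemma pips_step_stable (D : {set policy X A H}) x p p' (h : 'I_H) z :
  p \in PiH M H -> D \subset PiH M H -> pips_step M D x p p' ->
  solved p h -> V M p' h = bellman h ->
  V M p h.+1 z = bellman h.+1 z -> V M p' h.+1 z = bellman h.+1 z.
Proof.
move=> pPi DPi st ph p'h; have p'Pi := pips_step_PiH pPi DPi st.
have [->|zx] := eqVneq z x; first by move=> _; exact: pips_step_visited st _ _.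
move=> <-; rewrite !VS // p'h ph //; congr lookahead.
move: st; rewrite /pips_step; case: ifP => [_ -> //|_ [q [_ _ ->]] //].
Qed.

Lemma pips_step_solved (D : {set policy X A H}) x p p' h :
  p \in PiH M H -> D \subset PiH M H -> pips_step M D x p p' ->
  (h <= H)%N -> solved p h -> solved p' h.
Proof.
move=> pPi DPi st hH ph j; elim: j => [|j IH] jh; apply/funext => z.
  by rewrite V0.
have jH := leq_trans jh hH.
apply: (pips_step_stable (h := Ordinal jH)) st _ _ _ => //=.
- by move=> i ij; apply/ph/(leq_trans ij)/ltnW.
- exact/IH/ltnW.
- by rewrite ph.
Qed.

Lemma solved_beta (p : policy X A H) x :
  p \in PiH M H -> solved p H -> beta M p x = finset.set0.
Proof.
move=> pPi ph; apply/eqP/negbNE/negP => /set0Pn[q]; rewrite inE.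
move=> /andP[_ /existsP[I /and4P[/set0Pn[[i y] iI] II _ _]]].
move/(fintype.subsetP II): iI; rewrite inE => /andP[_ /negP]; apply=> /=.
by rewrite switchable_eq0 ?ph // ltnW.
Qed.

Lemma solved_optimal (p : policy X A H) :
  p \in PiH M H -> solved p H -> optimal M p.
Proof.
move=> pPi ph; split=> // x; apply/le_anti/andP; split.
  apply: ub_le_sup; last by exists p.
  by exists (bellman H x) => _ [q qPi <-]; exact: V_le_bellman.
apply: ge_sup; first by exists (V M p H x), p.
by move=> _ [q qPi <-]; rewrite ph //; exact: V_le_bellman.
Qed.

(** * Convergence of a single run that visits every state infinitely often *)

Section Run.
Variables (D : nat -> {set policy X A H}) (x : nat -> X).
Variable p : nat -> policy X A H.
Hypothesis p1 : p 1%N \in PiH M H.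
Hypothesis D_adm : forall k, (1 <= k)%N -> D k \subset PiH M H.
Hypothesis step : forall k, (1 < k)%N -> pips_step M (D k) (x k) (p k.-1) (p k).
Hypothesis recurrent : forall y m, exists2 k, (m <= k)%N & x k = y.

Lemma run_step k : (1 <= k)%N -> pips_step M (D k.+1) (x k.+1) (p k) (p k.+1).
Proof. by move=> k1; apply: step. Qed.

Lemma run_PiH k : (1 <= k)%N -> p k \in PiH M H.
Proof.
elim: k => // -[//|k] IH _.
by apply: pips_step_PiH (IH _) (D_adm _) (run_step _).
Qed.

Lemma run_solved h k l : (h <= H)%N -> (1 <= k)%N -> (k <= l)%N ->
  solved (p k) h -> solved (p l) h.
Proof.
move=> hH k1 /subnK <- pk; elim: (l - k)%N => [//|n IH].
have n1 : (1 <= n + k)%N by rewrite (leq_trans k1) ?leq_addl.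
exact: pips_step_solved (run_PiH n1) (D_adm _) (run_step n1) hH IH.
Qed.

Lemma run_stable (h : 'I_H) k l z : (1 <= k)%N -> (k <= l)%N ->
  solved (p k) h -> V M (p k) h.+1 z = bellman h.+1 z ->
  V M (p l) h.+1 z = bellman h.+1 z.
Proof.
move=> k1 /subnK <- pk Vk; elim: (l - k)%N => [//|n IH].
have n1 : (1 <= n + k)%N by rewrite (leq_trans k1) ?leq_addl.
have hH := ltnW (ltn_ord h).
have pn : solved (p (n + k)) h by apply: run_solved pk; rewrite ?leq_addl.
apply: (pips_step_stable (run_PiH n1) (D_adm _) (run_step n1) pn _ IH) => //.
exact: (pips_step_solved (run_PiH n1) (D_adm _) (run_step n1) hH pn).
Qed.

Lemma run_solved_level h : (h <= H)%N ->
  exists2 k, (1 <= k)%N & solved (p k) h.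
Proof.
elim: h => [|h IH] hH.
  by exists 1%N => // -[|//] _; apply/funext => z; rewrite V0.
have [k k1 pk] := IH (ltnW hH); pose h' := Ordinal hH.
suff [l kl pl] : exists2 l, (k <= l)%N &
    {in enum X, forall z, V M (p l) h.+1 z = bellman h.+1 z}.
  exists l => [|j]; first exact: leq_trans kl.
  rewrite leq_eqVlt => /orP[/eqP ->|]; last first.
    exact: (run_solved (ltnW hH) k1 kl pk).
  by apply/funext => z; rewrite pl ?mem_enum.
(* States are made optimal one by one; [run_stable] preserves those already treated. *)
elim: (enum X) => [|z s [l kl pl]]; first by exists k.
have l1 := leq_trans k1 kl.
(* A visit strictly after [l] occurs at some [m.+1] with [l <= m], so the step from [m] to [m.+1]
   starts from a policy solved up to [h]. *)
have [[//|m] lm xm] := recurrent z l.+1.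
have m1 := leq_trans l1 lm; have km := leq_trans kl lm.
exists m.+1 => [|y]; first exact: leqW.
rewrite inE => /orP[/eqP -> {y}|ys].
  rewrite -xm; apply: (pips_step_visited (h := h')) (run_step m1) _ _ => //.
  - exact: run_PiH.
  - exact: D_adm.
  - exact: run_solved (ltnW hH) k1 km pk.
  - by apply: (run_solved (ltnW hH) k1 (leqW km) pk).
apply: (run_stable (h := h') l1 (leqW lm)); last exact: pl.
exact: run_solved (ltnW hH) k1 kl pk.
Qed.

Lemma run_converges : exists K pistar,
  optimal M pistar /\ forall k, (K < k)%N -> p k = pistar.
Proof.
have [K K1 pK] := run_solved_level (leqnn H).
exists K, (p K); split; first by apply: solved_optimal pK; apply: run_PiH.
move=> k /ltnW /subnK <-; elim: (k - K)%N => [//|n IH].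
have n1 : (1 <= n + K)%N by rewrite (leq_trans K1) ?leq_addl.
rewrite addSn; have := run_step n1; rewrite /pips_step IH.
by rewrite solved_beta ?run_PiH // eqxx.
Qed.
End Run.
End Bellman.

(** * Reaching a state whatever the actions *)

Section Attractor.
Variables (R : realType) (X A : finType) (M : mdp R X A).

(* Iterating [attract y] from the empty set yields the states from which [y]
   is reached with positive probability in a bounded number of steps, however
   the actions are chosen. *)
Definition attract (y : X) (B : {set X}) : {set X} :=
  [set x | (x == y) ||
     [forall a in adm M x, [exists z in B, 0 < trans M x a z]]].

Lemma attract_mono y : {homo attract y : B C / B \subset C}.
Proof.
move=> B C BC; apply/fintype.subsetP => x; rewrite !inE => /orP[->//|/forallP xB].
apply/orP; right; apply/forallP => a; apply/implyP => ax.
have /existsP[z /andP[zB xz]] := implyP (xB a) ax.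
by apply/existsP; exists z; rewrite xz (fintype.subsetP BC).
Qed.

(* A rule leading outside the attractor at every state outside of it would
   make [y] inaccessible. *)
Lemma attractor_full (f0 : rule X A) y : communicating M -> f0 \in Pi M ->
  fixset (attract y) = [set: X].
Proof.
move=> M_comm f0Pi; pose B := fixset (attract y).
have BE : attract y B = B := fixsetK (@attract_mono y).
have yB : y \in B by rewrite -BE inE eqxx.
apply/setP => x; rewrite [RHS]inE -/B; apply/negbNE/negP => xB.
(* Outside [B] an acceptable action has no positive transition into [B]; one exists because [z] is
   not in [attract y B], which equals [B]. *)
pose ok z a := (a \in adm M z) && ((z \notin B) ==>
  [forall u in B, ~~ (0 < trans M z a u)]).
pose f : rule X A := [ffun z => odflt (f0 z) [pick a | ok z a]].
have f_ok z : ok z (f z).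
  rewrite ffunE; case: pickP => //= no.
  have f0z : f0 z \in adm M z by move: f0Pi; rewrite inE => /forallP.
  rewrite /ok f0z /=; apply/implyP => zB; move: (zB).
  rewrite -BE inE negb_or => /andP[_ /forallPn[a]]; rewrite negb_imply.
  move=> /andP[az naz]; have := no a; rewrite /ok az zB /=.
  move/negbT/negP; case; apply/forallP => u; apply/implyP => uB.
  by move: naz; rewrite negb_exists => /forallP/(_ u); rewrite uB.
have fPi : f \in Pi M.
  by rewrite inE; apply/forallP => z; have /andP[] := f_ok z.
have nstep0 n z : z \notin B -> nstep M f n z y = 0.
  elim: n z => [|n IH] z zB /=.
    by have [zy|//] := eqVneq z y; rewrite zy yB in zB.
  rewrite big1 // => u _; have [uB|uB] := boolP (u \in B); last first.
    by rewrite IH ?mulr0.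
  have /andP[az /implyP/(_ zB)/forallP/(_ u)/implyP/(_ uB)] := f_ok z.
  rewrite lt_neqAle trans_ge0 // andbT negbK => /eqP <-.
  by rewrite mul0r.
by have [[n]] := M_comm f fPi x y; rewrite nstep0 ?ltxx.
Qed.

(** The minimum of finitely many positive values; starting it at 1 gives [e <= 1], which keeps the
    factors [1 - e ^+ i] nonnegative. *)
Lemma trans_lower_bound : exists2 e : R, 0 < e <= 1 &
  forall x a y, 0 < trans M x a y -> e <= trans M x a y.
Proof.
exists (\big[Num.min/1]_(t : X * A * X | 0 < trans M t.1.1 t.1.2 t.2)
          trans M t.1.1 t.1.2 t.2).
  by rewrite lt_bigmin //= bigmin_le_id.
by move=> x a y xy; apply: (@bigmin_le_cond _ _ _ _ (x, a, y)).
Qed.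
End Attractor.

(** * Real-valued probabilities of events *)

Section FiniteProb.
Variables (R : realType) (d : measure_display) (Omega : measurableType d).
Variable Pr : probability Omega R.

Definition prob (E : set Omega) : R := fine (Pr E).

Lemma prob_ge0 E : 0 <= prob E.
Proof. exact: fine_ge0. Qed.

Lemma prob0 : prob set0 = 0.
Proof. by rewrite /prob measure0. Qed.

Lemma le_prob E F : measurable E -> measurable F -> (E `<=` F)%classic ->
  prob E <= prob F.
Proof.
move=> mE mF EF; rewrite fine_le ?fin_num_measure //.
by rewrite le_measure ?inE.
Qed.

Lemma prob_le1 E : measurable E -> prob E <= 1.
Proof. by move=> mE; rewrite -lee_fin fineK ?fin_num_measure ?probability_le1. Qed.

Lemma prob_partition (I : finType) (f : Omega -> I) E :
  measurable E -> (forall i, measurable [set w | f w = i]%classic) ->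
  prob E = \sum_i prob (E `&` [set w | f w = i])%classic.
Proof.
move=> mE mf; have mEf i : measurable (E `&` [set w | f w = i])%classic.
  exact: measurableI.
have EE : E = (\bigcup_(i in [set` index_enum I])
                 (E `&` [set w | f w = i]))%classic.
  apply/seteqP; split=> [w Ew|w [i _ []//]].
  by exists (f w) => //=; rewrite mem_index_enum.
rewrite {1}/prob {1}EE measure_fin_bigcup //; last first.
  by move=> i j _ _ [w [[_ <-] [_ <-]]].
rewrite -fsbig_seq ?index_enum_uniq // sum_fine //.
by move=> i _; rewrite fin_num_measure.
Qed.
End FiniteProb.

(** * Almost sure recurrence of every state *)

Section Recurrence.
Variables (R : realType) (X A : finType) (M : mdp R X A).
Variables (H : nat) (H_gt0 : (0 < H)%N).
Hypothesis M_comm : communicating M.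
Variables (pi1 : policy X A H) (pi1_adm : pi1 \in PiH M H).
Variables (d : measure_display) (Omega : measurableType d).
Variable Pr : probability Omega R.
Variable Delta : nat -> Omega -> {set policy X A H}.
Hypothesis Delta_adm : forall k w, (1 <= k)%N -> Delta k w \subset PiH M H.
Variables (x_ : nat -> Omega -> X) (pi_ : nat -> Omega -> policy X A H).
Hypothesis run : online_pips M H_gt0 pi1 Pr Delta x_ pi_.

Local Open Scope classical_set_scope.
Notation P := (prob Pr).

Lemma online_pips_adm k w : (1 <= k)%N -> pi_ k w \in PiH M H.
Proof.
apply: (run_PiH (D := fun k => Delta k w) (x := fun k => x_ k w)
  (p := fun k => pi_ k w)).
- by rewrite (pips_init run).
- by move=> j; exact: Delta_adm.
- by move=> j; exact: (pips_next run).
Qed.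

(** The conditioning event of [pips_transition]. *)
Definition history (n : nat) (xs : nat -> X) (ps : nat -> policy X A H) :=
  [set w | forall j, (1 <= j <= n)%N -> x_ j w = xs j /\ pi_ j w = ps j].

Definition set_at (T : Type) (k : nat) (v : T) (f : nat -> T) : nat -> T :=
  fun j => if j == k then v else f j.

Lemma history0 xs ps : history 0 xs ps = setT.
Proof.
apply/seteqP; split=> // w _ j /andP[j1 j0].
by move: (leq_trans j1 j0).
Qed.

Lemma historyS n xs ps :
  history n.+1 xs ps =
  history n xs ps `&` [set w | x_ n.+1 w = xs n.+1]
                  `&` [set w | pi_ n.+1 w = ps n.+1].
Proof.
apply/seteqP; split=> [w hw|w [[hw xw] pw] j /andP[j1]].
  split; last by have [] := hw n.+1; rewrite ?leqnn.
  split=> [j /andP[j1 jn]|]; last by have [] := hw n.+1; rewrite ?leqnn.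
  by apply: hw; rewrite j1 leqW.
rewrite leq_eqVlt ltnS => /orP[/eqP ->//|jn].
by apply: hw; rewrite j1.
Qed.

Lemma history_set_at n xs ps z p :
  history n.+1 (set_at n.+1 z xs) (set_at n.+1 p ps) =
  history n xs ps `&` [set w | x_ n.+1 w = z] `&` [set w | pi_ n.+1 w = p].
Proof.
rewrite historyS /set_at eqxx; congr (_ `&` _ `&` _).
by apply/seteqP; split=> w hw j jn; have := hw j jn;
  rewrite ltn_eqF //; case/andP: jn.
Qed.

Lemma measurable_history n xs ps : measurable (history n xs ps).
Proof.
elim: n => [|n IH]; first by rewrite history0.
rewrite historyS; apply: measurableI.
  by apply: measurableI => //; exact: (state_measurable run).
exact: (policy_measurable run).
Qed.

Definition avoid (y : X) (n : nat) :=
  [set w | forall j, (n <= j)%N -> x_ j w <> y].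

Lemma measurable_avoid y n : (1 <= n)%N -> measurable (avoid y n).
Proof.
move=> n1; have -> : avoid y n = \bigcap_(j in [set j | (n <= j)%N])
    ~` [set w | x_ j w = y] by apply/seteqP; split.
apply: bigcap_measurable => [|j nj]; first by exists n => /=.
by apply: measurableC; apply: (state_measurable run); exact: leq_trans nj.
Qed.

Lemma le_avoid y m n : (m <= n)%N -> avoid y m `<=` avoid y n.
Proof. by move=> mn w wm j nj; apply/wm/(leq_trans mn). Qed.

Lemma prob_history_split n xs ps E : measurable E ->
  P (history n xs ps `&` E) =
  \sum_z \sum_p
    P (history n.+1 (set_at n.+1 z xs) (set_at n.+1 p ps) `&` E).
Proof.
move=> mE; have mhE : measurable (history n xs ps `&` E).
  exact/measurableI/mE/measurable_history.
rewrite (@prob_partition _ _ _ Pr _ (x_ n.+1)); last 2 first.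
- exact: mhE.
- by move=> z; exact: (state_measurable run).
apply: eq_bigr => z _; rewrite (@prob_partition _ _ _ Pr _ (pi_ n.+1)); last 2 first.
- by apply: measurableI => //; exact: (state_measurable run).
- by move=> p; exact: (policy_measurable run).
apply: eq_bigr => p _; congr prob; rewrite history_set_at.
by rewrite (setIAC _ E) (setIAC _ E).
Qed.

(** Summing out the new policy leaves an event about the next state alone, to which
    [pips_transition] applies however the policy depends on the outcome. *)
Lemma prob_history_step n xs ps z : (1 <= n)%N ->
  \sum_p P (history n.+1 (set_at n.+1 z xs) (set_at n.+1 p ps)) =
  P (history n xs ps) * trans M (xs n) (tnth (ps n) (Ordinal H_gt0) (xs n)) z.
Proof.
move=> n1; under eq_bigr do rewrite history_set_at.
rewrite -prob_partition; last 2 first.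
- apply: measurableI; first exact: measurable_history.
  exact: (state_measurable run).
- by move=> p; exact: (policy_measurable run).
rewrite /prob (pips_transition run) // fineM //.
by rewrite fin_num_measure //; exact: measurable_history.
Qed.

(* A bound c for the probability of never visiting y, uniform in the past, is
   improved by the factor 1 - e ^ i in the i-th iterate of [attract y]; from c = 1
   this is iterated in [prob_history_avoid]. *)
Lemma prob_history_avoid_step y (e c : R) i n xs ps :
  0 < e <= 1 -> (forall x a z, 0 < trans M x a z -> e <= trans M x a z) ->
  0 <= c ->
  (forall n xs ps, (1 <= n)%N ->
     P (history n xs ps `&` avoid y n) <= c * P (history n xs ps)) ->
  (1 <= n)%N -> xs n \in iter i (attract M y) finset.set0 ->
  P (history n xs ps `&` avoid y n) <= c * (1 - e ^+ i) * P (history n xs ps).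
Proof.
move=> /andP[e0 e1] eP c0 Pc.
have pow_le1 j : 0 <= 1 - e ^+ j by rewrite subr_ge0 exprn_ile1 // ltW.
elim: i n xs ps => [|i IH] n xs ps n1 /=; first by rewrite inE.
have rhs0 : 0 <= c * (1 - e ^+ i.+1) * P (history n xs ps).
  by rewrite !mulr_ge0 // prob_ge0.
rewrite inE => /orP[/eqP xy|att].
  rewrite (_ : _ `&` _ = set0) ?prob0 //.
  apply/seteqP; split=> // w [hw /(_ n (leqnn n))]; apply.
  by have [|-> _] := hw n; rewrite ?n1 ?leqnn.
have mh := measurable_history; have ma := measurable_avoid.
set a := tnth (ps n) (Ordinal H_gt0) (xs n).
(* An inadmissible [a] makes the history empty, as all policies of the run are admissible. *)
have [ax|ax] := boolP (a \in adm M (xs n)); last first.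
  rewrite (_ : _ `&` _ = set0) ?prob0 //.
  apply/seteqP; split=> // w [hw _]; case/negP: ax; rewrite /a.
  have [|_ <-] := hw n; rewrite ?n1 ?leqnn //.
  exact/tnth_adm/online_pips_adm.
(* Whatever [a] is, it leads with probability at least [e] to some state [z0] of the previous
   iterate. *)
have /existsP[z0 /andP[z0i /eP ez0]] := implyP (forallP att a) ax.
have n2 : (1 <= n.+1)%N by [].
apply: (@le_trans _ _ (P (history n xs ps `&` avoid y n.+1))).
  apply: le_prob; [exact/measurableI/ma|exact/measurableI/ma|].
  by apply: setIS; exact: le_avoid.
rewrite prob_history_split; last exact: ma.
(* The induction hypothesis improves the bound after a move to [z0]; elsewhere [c] is kept.
   Averaging over [z] gives [c] times 1 minus [e ^+ i] weighted by the probability of [z0], which is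
   at most [c * (1 - e ^+ i.+1)]. *)
pose c' z := c * (1 - (z == z0)%:R * e ^+ i).
apply: (@le_trans _ _ (\sum_z \sum_p
    c' z * P (history n.+1 (set_at n.+1 z xs) (set_at n.+1 p ps)))).
  apply: ler_sum => z _; apply: ler_sum => p _; rewrite /c'.
  have [zz0|_] := eqVneq z z0; last by rewrite mul0r subr0 mulr1 Pc.
  by rewrite mul1r; apply: IH; rewrite // /set_at eqxx zz0.
under eq_bigr do rewrite -mulr_sumr prob_history_step // -/a mulrCA.
rewrite -mulr_sumr mulrC ler_wpM2r ?prob_ge0 //.
under eq_bigr do rewrite /c' -mulrA mulrBl mul1r -mulrA.
rewrite -mulr_sumr ler_wpM2l // sumrB trans_sum1 // lerB //.
rewrite (bigD1 z0) //= eqxx mul1r [X in _ + X]big1 ?addr0.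
  by rewrite exprSr ler_wpM2l // exprn_ge0 // ltW.
by move=> z /negbTE ->; rewrite mul0r.
Qed.

Lemma prob_history_avoid y n xs ps : (1 <= n)%N ->
  P (history n xs ps `&` avoid y n) = 0.
Proof.
move=> n1; have [e /andP[e0 e1] eP] := trans_lower_bound M.
(* [fixset] is the [#|X|]-th iterate from the empty set, and by [attractor_full] it contains every
   state, so the improvement step always applies with [i = #|X|]. *)
pose q := 1 - e ^+ #|X|.
have q0 : 0 <= q by rewrite subr_ge0 exprn_ile1 // ltW.
have f0Pi : tnth pi1 (Ordinal H_gt0) \in Pi M.
  by move: pi1_adm; rewrite inE => /forallP.
have decay j : forall n xs ps, (1 <= n)%N ->
    P (history n xs ps `&` avoid y n) <= q ^+ j * P (history n xs ps).
  elim: j => [|j IH] m ys rs m1.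
    rewrite expr0 mul1r; apply: le_prob; last exact: subIsetl.
      by apply: measurableI; [exact: measurable_history|exact: measurable_avoid].
    exact: measurable_history.
  rewrite exprSr; apply: prob_history_avoid_step; rewrite ?e0 ?exprn_ge0 //.
  by have /setP/(_ (ys m)) := attractor_full y M_comm f0Pi; rewrite [RHS]inE.
apply/le_anti; rewrite prob_ge0 andbT.
have q1 : `|q| < 1 by rewrite ger0_norm // ltrBlDr ltrDl exprn_gt0.
apply: cvgr_to_ge (cvg_expr q1) _.
apply: nearW => j; apply: le_trans (decay j n xs ps n1) _.
by rewrite ler_piMr ?exprn_ge0 ?prob_le1 //; exact: measurable_history.
Qed.

(** The event is split over the histories up to time [n], each contributing 0; the induction
    shortens them to length 0, where the history is the sure event. *)
Lemma prob_avoid y n : (1 <= n)%N -> P (avoid y n) = 0.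
Proof.
move=> n1; have mn := measurable_avoid y n1.
suff h0 i : (i <= n)%N -> forall xs ps,
    P (history (n - i) xs ps `&` avoid y n) = 0.
  have := h0 n (leqnn n) (fun=> y) (fun=> pi1).
  by rewrite subnn history0 setTI.
elim: i => [|i IH] iN xs ps; first by rewrite subn0 prob_history_avoid.
rewrite prob_history_split // big1 // => z _; rewrite big1 // => p _.
by rewrite subnSK // IH // ltnW.
Qed.

Lemma state_recurrent :
  {ae Pr, forall w y m, exists2 k, (m <= k)%N & x_ k w = y}.
Proof.
apply: filter_forall => y; apply: ae_foralln => m.
(* The run starts at time 1, hence [m.+1]: having no visit from [m] on implies having none from
   [m.+1] on. *)
exists (avoid y m.+1); split.
- exact: measurable_avoid.
- rewrite -[LHS]fineK; last by rewrite fin_num_measure //; exact: measurable_avoid.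
  by congr EFin; exact: prob_avoid.
- move=> w /= nk j mj xj; apply: nk; exists j => //; exact: ltnW.
Qed.
End Recurrence.

Theorem mainTheorem3 (R : realType) (X A : finType) (M : mdp R X A)
  (H : nat) (H_gt0 : (0 < H)%N)
  (M_comm : communicating M)
  (pi1 : policy X A H) (pi1_adm : pi1 \in PiH M H)
  (d : measure_display) (Omega : measurableType d) (Pr : probability Omega R)
  (Delta : nat -> Omega -> {set policy X A H})
  (Delta_adm : forall k w, (1 <= k)%N -> Delta k w \subset PiH M H)
  (x_ : nat -> Omega -> X) (pi_ : nat -> Omega -> policy X A H)
  (run : online_pips M H_gt0 pi1 Pr Delta x_ pi_) :
  {ae Pr, forall w, exists (K : nat) (pistar : policy X A H),
     optimal M pistar /\ forall k, (K < k)%N -> pi_ k w = pistar}.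
Proof.
have f0Pi : tnth pi1 (Ordinal H_gt0) \in Pi M.
  by move: pi1_adm; rewrite inE => /forallP.
have := state_recurrent M_comm pi1_adm Delta_adm run.
(* The rest is pathwise: [run_converges] applies to each outcome at which all states recur. *)
apply: filterS => w rec.
apply: (run_converges f0Pi (D := fun k => Delta k w) (x := fun k => x_ k w)
  (p := fun k => pi_ k w)) => //.
- by rewrite (pips_init run).
- by move=> k; exact: Delta_adm.
- by move=> k; exact: (pips_next run).
Qed.
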